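(* Every left amenable semigroup $S$ of rational maps admits a common invariant probability measure on $\overline{\mathbb{C}}$, that is, a Borel probability measure $\mu$ on $\overline{\mathbb{C}}$ with $g_*\mu=\mu$ for every $g\in S$.
   Context: A semigroup of rational maps is a non-empty family of rational maps of $\overline{\mathbb{C}}$ closed under composition, with composition as product. $S$ is left amenable if there is a mean $M$ (positive continuous linear functional with $M(1)=1$) on the space $L_\infty(S)$ of bounded complex functions on $S$ (supremum norm) such that $M(l_s\phi)=M(\phi)$ for all $s\in S$, $\phi\in L_\infty(S)$, where $(l_s\phi)(t)=\phi(st)$. *)

(* Defs.v *)
From HB Require Import structures.
From mathcomp Require Import all_boot all_order all_algebra.
From mathcomp Require Import complex.
From mathcomp Require Import all_classical all_reals all_analysis.

Set Implicit Arguments.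
Unset Strict Implicit.
Unset Printing Implicit Defensive.

Import Order.TTheory GRing.Theory Num.Theory.
Import numFieldNormedType.Exports.

Local Open Scope classical_set_scope.
Local Open Scope ring_scope.
Local Open Scope complex_scope.

(* [R[i]^o] is the type [R[i]] equipped with the topology of the complex
   modulus; [None] is the point at infinity. *)
Definition riemann_sphere (R : realType) : topologicalType :=
  one_point_compactification R[i]^o.

Definition borel_sphere (R : realType) :=
  g_sigma_algebraType (@open (riemann_sphere R)).

Section RationalMaps.
Variable R : realType.
Local Notation sphere := (riemann_sphere R).

(* The point with homogeneous coordinates [a : b], for (a, b) != (0, 0). *)
Definition sphere_point (a b : R[i]) : sphere :=
  if b == 0 then None else Some (a / b).

(* The map z |-> P(z) / Q(z), for coprime P and Q. At infinity, with n the
   larger of the two degrees, it takes the value [P_n : Q_n] of its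
   homogenization at [1 : 0]. *)
Definition rational_eval (P Q : {poly R[i]}) (z : sphere) : sphere :=
  match z with
  | Some w => sphere_point P.[w] Q.[w]
  | None => let n := (maxn (size P) (size Q)).-1 in sphere_point P`_n Q`_n
  end.

(* Constant maps are included, the constant map at infinity being given by
   P = 1 and Q = 0. *)
Definition rational_map (f : sphere -> sphere) : Prop :=
  exists P Q : {poly R[i]}, coprimep P Q /\ f = rational_eval P Q.

Record rational_semigroup := RationalSemigroup {
  ratsg_set :> set (sphere -> sphere);
  ratsg_nonempty : ratsg_set !=set0;
  ratsg_rational : forall f, ratsg_set f -> rational_map f;
  ratsg_comp : forall f g, ratsg_set f -> ratsg_set g -> ratsg_set (f \o g) }.

Definition ratsg_elt (S : rational_semigroup) : Type := set_type (ratsg_set S).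

Section Product.
Variable S : rational_semigroup.

HB.instance Definition _ := Choice.on (ratsg_elt S).

Lemma ratsg_mul_subproof (f g : ratsg_elt S) :
  val f \o val g \in ratsg_set S.
Proof. exact/mem_set/ratsg_comp/(set_valP g)/(set_valP f). Qed.

Definition ratsg_mul (f g : ratsg_elt S) : ratsg_elt S :=
  exist _ (val f \o val g) (ratsg_mul_subproof f g).

Lemma ratsg_mulA : associative ratsg_mul.
Proof. by move=> f g h; apply: val_inj. Qed.

HB.instance Definition _ := isSemigroup.Build (ratsg_elt S) ratsg_mulA.

End Product.
End RationalMaps.

Section BoundedFunctions.
Variables (R : realType) (S : Type).
Local Notation C := (R[i]^o).

Lemma bounded_funP (f : S -> C) :
  bounded_fun f <-> exists M : R, forall s, `|f s| <= M%:C.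
Proof.
split=> [[M [Mreal fM]]|[M fM]].
  exists (complex.Re (M + 1)) => s.
  have M1real : M + 1 \is Num.real by rewrite realD ?real1.
  by rewrite RRe_real//; apply: fM => //; rewrite ltrDl.
exists M%:C; split=> [|N MN s _ /=]; first by apply/complex_realP; exists M.
exact: le_trans (fM s) (ltW MN).
Qed.

Definition Linf_pred : {pred (S -> C)} := mem [set f : S -> C | bounded_fun f].

Lemma Linf_submod_closed : submod_closed Linf_pred.
Proof.
split=> [|a f g].
  by rewrite inE; apply/bounded_funP; exists 0 => s /=; rewrite normr0.
rewrite !inE => /bounded_funP[M fM] /bounded_funP[N gN].
apply/bounded_funP; exists (Normc.normc a * M + N) => s.
rewrite rmorphD rmorphM (le_trans (ler_normD _ _))// lerD//.
by rewrite normrZ ler_wpM2l.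
Qed.

HB.instance Definition _ :=
  GRing.isSubmodClosed.Build _ _ Linf_pred Linf_submod_closed.

Record Linf := MkLinf { Linf_val :> S -> C; _ : Linf_val \in Linf_pred }.

HB.instance Definition _ := [isSub for Linf_val].
HB.instance Definition _ := [Choice of Linf by <:].
HB.instance Definition _ := [SubChoice_isSubLmodule of Linf by <:].

Lemma LinfP (f g : Linf) : f = g <-> forall s, f s = g s.
Proof. by split=> [->//|fg]; apply/val_inj/funext. Qed.

Lemma Linf_bounded (f : Linf) : bounded_fun f.
Proof. by case: f => f /=; rewrite inE. Qed.

Definition Linf_of (f : S -> C) (fb : bounded_fun f) : Linf :=
  MkLinf (mem_set fb : f \in Linf_pred).

Definition supnorm (f : Linf) : R := sup (range (fun s => Normc.normc (f s))).

Lemma supnorm_ub (f : Linf) s : `|f s| <= (supnorm f)%:C.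
Proof.
rewrite lecR; apply: ub_le_sup; last by exists s.
have /bounded_funP[M fM] := Linf_bounded f.
by exists M => _ [t _ <-]; rewrite -lecR; exact: fM.
Qed.

Lemma supnorm_le (f : Linf) (M : R) :
  0 <= M -> (forall s, `|f s| <= M%:C) -> supnorm f <= M.
Proof.
move=> M0 fM; rewrite /supnorm.
have [->|/set0P ne0] := eqVneq (range (fun s => Normc.normc (f s))) set0.
  by rewrite sup0.
by apply: ge_sup => // _ [t _ <-]; rewrite -lecR; exact: fM.
Qed.

Lemma supnorm_ge0 (f : Linf) : 0 <= supnorm f.
Proof.
rewrite /supnorm; have [->|/set0P[_ [s _ _]]] :=
  eqVneq (range (fun s => Normc.normc (f s))) set0; first by rewrite sup0.
by rewrite -lecR; exact: le_trans (normr_ge0 (f s)) (supnorm_ub f s).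
Qed.

Lemma ler_supnormD (f g : Linf) :
  (supnorm (f + g))%:C <= (supnorm f)%:C + (supnorm g)%:C.
Proof.
rewrite -rmorphD lecR; apply: supnorm_le => [|s].
  by rewrite addr_ge0// supnorm_ge0.
by rewrite rmorphD (le_trans (ler_normD _ _))// lerD// supnorm_ub.
Qed.

Lemma supnormZ (a : R[i]) (f : Linf) :
  (supnorm (a *: f))%:C = `|a| * (supnorm f)%:C.
Proof.
have le_supnormZ b h : supnorm (b *: h) <= Normc.normc b * supnorm h.
  apply: supnorm_le => [|s].
    by rewrite mulr_ge0 ?supnorm_ge0// -lecR; exact: (normr_ge0 b).
  by rewrite rmorphM normrZ ler_wpM2l// supnorm_ub.
rewrite -[`|a|]/((Normc.normc a)%:C) -rmorphM; congr (_%:C).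
apply/eqP; rewrite eq_le le_supnormZ /=.
have [->|a0] := eqVneq a 0.
  by rewrite Normc.normc0 mul0r supnorm_ge0.
have na0 : 0 < Normc.normc a by rewrite -ltcR -[ltRHS]/(`|a|) normr_gt0.
rewrite -ler_pdivlMl// -Normc.normcV -{1}[f](scalerK a0).
exact: le_supnormZ.
Qed.

Lemma supnorm_eq0 (f : Linf) : (supnorm f)%:C = 0 -> f = 0.
Proof.
move=> f0; apply/LinfP => s; apply/eqP; rewrite -normr_le0 -f0.
exact: supnorm_ub.
Qed.

HB.instance Definition _ :=
  Lmodule_isNormed.Build R[i] Linf ler_supnormD supnormZ supnorm_eq0.

End BoundedFunctions.

Section Amenability.
Variables (R : realType) (S : semigroupType).
Local Notation C := (R[i]^o).

Lemma cst_bounded (c : C) : bounded_fun (fun _ : S => c).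
Proof. by apply/bounded_funP; exists (Normc.normc c). Qed.

Lemma translate_bounded (s : S) (phi : Linf R S) :
  bounded_fun (fun t => phi (s * t)%g).
Proof.
by apply/bounded_funP; exists (supnorm phi) => t; exact: supnorm_ub.
Qed.

Definition Linf_one : Linf R S := Linf_of (cst_bounded 1).

Definition left_translate (s : S) (phi : Linf R S) : Linf R S :=
  Linf_of (translate_bounded s phi).

(* In [R[i]], [0 <= z] means that [z] is real and nonnegative. *)
Definition is_mean (M : {linear Linf R S -> C}) : Prop :=
  [/\ forall phi : Linf R S, (forall s, 0 <= phi s) -> 0 <= M phi,
      continuous M
    & M Linf_one = 1].

Definition left_amenable : Prop :=
  exists M : {linear Linf R S -> C}, is_mean M /\
    forall (s : S) (phi : Linf R S), M (left_translate s phi) = M phi.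

End Amenability.

(* Main.v *)
Require Import Defs.
From HB Require Import structures.
From mathcomp Require Import all_boot all_order all_algebra.
From mathcomp Require Import complex.
From mathcomp Require Import all_classical all_reals all_analysis.

(** An invariant mean [M] on [S] is turned into an invariant measure by pushing
it forward along an orbit. Fix a point [z0] of the sphere; for an arbitrary set
[A], let [m A] be the mean of the indicator function of the set of [s] in [S]
with [s z0] in [A] ([mean_distribution]). This [m] is a finitely additive
probability on all subsets of the sphere. Evaluating it at the preimage of [A]
under [g] amounts to translating the indicator function on the left by [g],
because [g (s z0) = (g \o s) z0]; so left invariance of [M] says exactly that
[m (g @^-1` A) = m A] for every [g] in [S].

Finite additivity is upgraded to countable additivity as in the Riesz
representation theorem, working with sets instead of continuous functions. On
a compact Hausdorff space put [lambda U = sup m K], for [K] closed in [U], and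
[mu A = inf lambda U], for [U] open around [A]. Normality of the space makes
[lambda] subadditive on open sets and compactness makes it countably so, hence
[mu] is an outer measure; open sets satisfy the Caratheodory criterion, so [mu]
restricts to a Borel probability which equals [lambda] on open sets
([regularization_borel_probability]). If [g] is continuous and preserves [m],
then [lambda (g @^-1` U) = lambda U]: a closed [K] in [U] has a closed preimage
in [g @^-1` U] of the same [m]-mass, and a closed [K] in [g @^-1` U] has a
closed image in [U], of mass at least [m K]. As open sets are stable under
intersection and generate the Borel sets, [mu] is invariant under [g]
([finadd_invariant_measure]).

It remains to see that rational maps are continuous on the sphere and that the
sphere is compact Hausdorff. The former rests on the continuity of
[(a, b) |-> [a : b]] away from [(0, 0)] ([cvg_sphere_point]); the point at
infinity is handled in the coordinate [1 / z]. *)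

Set Implicit Arguments.
Unset Strict Implicit.
Unset Printing Implicit Defensive.

Import Order.TTheory GRing.Theory Num.Theory.
Import numFieldNormedType.Exports.

Local Open Scope classical_set_scope.
Local Open Scope ring_scope.
Local Open Scope complex_scope.

(** * Regularization of a finitely additive probability *)

Record finadd_probability (T : Type) (R : realType) := FinaddProbability {
  finadd_fun :> set T -> R;
  finadd_ge0 : forall A, 0 <= finadd_fun A;
  finadd_setT : finadd_fun setT = 1;
  finaddU : forall A B, A `&` B = set0 ->
    finadd_fun (A `|` B) = finadd_fun A + finadd_fun B }.

Section FinitelyAdditive.
Variables (T : Type) (R : realType) (m : finadd_probability T R).
Implicit Types A B : set T.

Lemma finadd_set0 : m set0 = 0.
Proof.
have := finaddU m (setI0 set0); rewrite setU0 => /esym/eqP.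
by rewrite -subr_eq0 addrK => /eqP.
Qed.

Lemma finadd_setDI A B : m A = m (A `\` B) + m (A `&` B).
Proof.
rewrite -finaddU; first by rewrite -setDDr setDv setD0.
by apply/seteqP; split=> // x [[_ nB] [_ /nB]].
Qed.

Lemma le_finadd A B : A `<=` B -> m A <= m B.
Proof.
by move=> AB; rewrite (finadd_setDI B A) (setIidr AB) lerDr finadd_ge0.
Qed.

Lemma finadd_le1 A : m A <= 1.
Proof. by rewrite -(finadd_setT m) le_finadd. Qed.

Lemma le_finaddU A B : m (A `|` B) <= m A + m B.
Proof.
rewrite (finadd_setDI _ A) addrC lerD//; first by rewrite le_finadd// => x [].
by apply: le_finadd => x [[]].
Qed.

End FinitelyAdditive.

Section Regularization.
Variables (T : ptopologicalType) (R : realType) (m : finadd_probability T R).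
Implicit Types A U V K : set T.
Local Open Scope ereal_scope.

(** Closed sets approximate from inside: in a compact Hausdorff space this is
the value that the Riesz measure of the functional [f |-> \int f dm] takes at
an open set [U]. *)
Definition inner_content U : \bar R :=
  ereal_sup [set (m K)%:E | K in [set K | closed K /\ K `<=` U]].

Definition outer_content A : \bar R :=
  ereal_inf [set inner_content U | U in [set U | open U /\ A `<=` U]].

Lemma inner_content_ub U K : closed K -> K `<=` U ->
  (m K)%:E <= inner_content U.
Proof. by move=> cK KU; apply: ereal_sup_ubound; exists K. Qed.

Lemma inner_content_le U (x : \bar R) :
  (forall K, closed K -> K `<=` U -> (m K)%:E <= x) -> inner_content U <= x.
Proof. by move=> h; apply: ge_ereal_sup => _ [K [cK KU] <-]; exact: h. Qed.

Lemma le_inner_content U V : U `<=` V -> inner_content U <= inner_content V.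
Proof.
move=> UV; apply: inner_content_le => K cK KU.
by apply: inner_content_ub => //; exact: subset_trans UV.
Qed.

Lemma inner_content_ge0 U : 0 <= inner_content U.
Proof.
apply: le_trans (inner_content_ub closed0 (@sub0set _ U)).
by rewrite finadd_set0.
Qed.

Lemma inner_content_setT : inner_content setT = 1.
Proof.
apply/eqP; rewrite eq_le; apply/andP; split.
  by apply: inner_content_le => K _ _; rewrite lee_fin finadd_le1.
apply: le_trans (inner_content_ub closedT (@subset_refl _ setT)).
by rewrite finadd_setT.
Qed.

Lemma inner_content_fin U : inner_content U \is a fin_num.
Proof.
rewrite ge0_fin_numE ?inner_content_ge0//.
by rewrite (@le_lt_trans _ _ 1) ?ltry// -inner_content_setT le_inner_content.
Qed.

Lemma outer_content_lb A U : open U -> A `<=` U ->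
  outer_content A <= inner_content U.
Proof. by move=> oU AU; apply: ereal_inf_lbound; exists U. Qed.

Lemma outer_content_ge A (x : \bar R) :
  (forall U, open U -> A `<=` U -> x <= inner_content U) ->
  x <= outer_content A.
Proof. by move=> h; apply: le_ereal_inf_tmp => _ [U [oU AU] <-]; exact: h. Qed.

Lemma outer_content_open U : open U -> outer_content U = inner_content U.
Proof.
move=> oU; apply/eqP; rewrite eq_le outer_content_lb//=.
by apply: outer_content_ge => V _; exact: le_inner_content.
Qed.

Lemma le_outer_content A B : A `<=` B -> outer_content A <= outer_content B.
Proof.
move=> AB; apply: outer_content_ge => U oU BU.
by apply: outer_content_lb => //; exact: subset_trans BU.
Qed.

Lemma outer_content_ge0 A : 0 <= outer_content A.
Proof. by apply: outer_content_ge => U _ _; exact: inner_content_ge0. Qed.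

Lemma outer_content_fin A : outer_content A \is a fin_num.
Proof.
rewrite ge0_fin_numE ?outer_content_ge0//.
rewrite (@le_lt_trans _ _ 1) ?ltry// -inner_content_setT.
by apply: outer_content_lb => //; exact: openT.
Qed.

Lemma outer_content0 : outer_content set0 = 0.
Proof.
rewrite outer_content_open; last exact: open0.
apply/eqP; rewrite eq_le inner_content_ge0 andbT.
by apply: inner_content_le => K _; rewrite subset0 => ->; rewrite finadd_set0.
Qed.

Hypotheses (hT : hausdorff_space T) (cT : compact [set: T]).

(** A closed subset of [U `|` V] is the union of a closed subset of [U] and a
closed subset of [V]: normality separates its parts outside [U] and outside
[V] by open sets, and removing one or the other leaves the two pieces. *)
Lemma inner_contentU U V : open U -> open V ->
  inner_content (U `|` V) <= inner_content U + inner_content V.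
Proof.
move=> oU oV; apply: inner_content_le => K cK KUV.
have closedD W : open W -> closed (K `\` W).
  by move=> oW; apply: closedI => //; exact: open_closedC.
have /(@normal_openP R)/(_ _ _ (closedD _ oU) (closedD _ oV)) :=
  compact_normal hT cT.
case=> [|W1 [W2 [oW1 oW2 UW1 VW2 W12]]].
  by rewrite -subset0 => x [[/KUV[Ux|Vx] nU] [_ nV]]; [exact: nU|exact: nV].
have K12 : K = (K `\` W1) `|` (K `\` W2).
  by rewrite -setDIr W12 setD0.
rewrite {1}K12; apply: (@le_trans _ _ ((m (K `\` W1))%:E + (m (K `\` W2))%:E)).
  by rewrite -EFinD lee_fin le_finaddU.
apply: leeD; apply: inner_content_ub; try exact: closedD.
  by move=> x [Kx nx]; apply: contrapT => /(conj Kx)/UW1.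
by move=> x [Kx nx]; apply: contrapT => /(conj Kx)/VW2.
Qed.

(** Here compactness enters: a closed set covered by all the [U n] is covered
by finitely many of them, so that the finite case is enough. *)
Lemma inner_content_bigcup (U : (set T)^nat) : (forall n, open (U n)) ->
  inner_content (\bigcup_n U n) <= \sum_(n <oo) inner_content (U n).
Proof.
move=> oU; apply: inner_content_le => K cK KU.
have : compact K by apply: subclosed_compact cK cT _.
rewrite compact_cover => /(_ _ setT U)[//|//|D _ KD].
pose N := (\max_(i <- finmap.enum_fset D) i).+1.
have KN : K `<=` \big[setU/set0]_(i < N) U i.
  move=> x /KD[i /= iD Uix]; rewrite -bigcup_mkord; exists i => //=.
  by rewrite /N ltnS; apply: leq_bigmax_seq.
apply: (le_trans (inner_content_ub cK KN)).
apply: (@le_trans _ _ (\sum_(i < N) inner_content (U i))); last first.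
  rewrite -(big_mkord xpredT (fun i => inner_content (U i))).
  by apply: nneseries_lim_ge => n *; exact: inner_content_ge0.
elim: N {KN} => [|n IH].
  by rewrite !big_ord0 -outer_content_open ?outer_content0//; exact: open0.
rewrite !big_ord_recr/=; apply: (le_trans (inner_contentU _ _)) => //.
  by rewrite -bigcup_mkord; apply: bigcup_open.
by apply: leeD.
Qed.

Lemma outer_content_sigma_subadditive : sigma_subadditive outer_content.
Proof.
move=> A; apply/lee_addgt0Pr => e e0.
apply: le_trans (epsilon_trick _ _ (ltW e0)); last first.
  by move=> n; exact: outer_content_ge0.
pose P n U := [/\ open U, A n `<=` U &
  inner_content U <= outer_content (A n) + (e / (2 ^ n.+1)%:R)%:E].
have [U PU] : {U : (set T)^nat & forall n, P n (U n)}.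
  apply: (@choice _ _ P) => n.
  have en : (0 < e / (2 ^ n.+1)%:R)%R.
    by rewrite divr_gt0// ltr0n expn_gt0.
  have /(lb_ereal_inf_adherent en) := outer_content_fin (A n).
  by move=> [_ [U [oU AU] <-] /ltW hU]; exists U.
apply: (@le_trans _ _ (inner_content (\bigcup_n U n))).
  apply: outer_content_lb; first by apply: bigcup_open => i _; have [] := PU i.
  by apply: subset_bigcup => i _; have [] := PU i.
apply: le_trans (inner_content_bigcup _) _ => [n|]; first by have [] := PU n.
apply: lee_nneseries => n *; first exact: inner_content_ge0.
by have [] := PU n.
Qed.

(** Caratheodory's criterion for open sets, after choosing [V] open around [A]:
exhaust [V `&` U] by a closed [K]; then [V `\` K] is an open set around
[A `&` ~` U] which can be exhausted by a closed [L], disjoint from [K], and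
[m K + m L = m (K `|` L)] is at most the content of [V]. *)
Lemma outer_content_open_caratheodory (U : set T) : open U ->
  forall A, outer_content (A `&` U) + outer_content (A `&` ~` U)
            <= outer_content A.
Proof.
move=> oU A; apply: outer_content_ge => V oV AV.
apply: (@le_trans _ _ (inner_content (V `&` U) + outer_content (A `&` ~` U))).
  apply: leeD2r; apply: outer_content_lb; first exact: openI.
  exact: setSI.
rewrite -leeBrDr ?outer_content_fin//.
apply: inner_content_le => K cK KVU; rewrite leeBrDr ?outer_content_fin//.
apply: (@le_trans _ _ ((m K)%:E + inner_content (V `\` K))).
  apply: leeD2l; apply: outer_content_lb.
    by apply: openI => //; exact: closed_openC.
  by move=> x [/AV Vx nUx]; split=> // /KVU[].
rewrite addeC -leeBrDr//; apply: inner_content_le => L cL LV.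
rewrite leeBrDr// -EFinD -finaddU; last first.
  by rewrite -subset0 => x [/LV[]].
apply: inner_content_ub; first exact: closedU.
by move=> x [/LV[]|/KVU[]].
Qed.

(** Caratheodory's theorem provides a sigma-algebra on which the outer content
is countably additive; it contains the open sets, hence the Borel sets. *)
Lemma regularization_borel_probability :
  exists mu : probability (g_sigma_algebraType (@open T)) R,
    forall U, open U -> mu U = inner_content U.
Proof.
pose oM := isOuterMeasure.Build R T outer_content outer_content0
  outer_content_ge0 le_outer_content outer_content_sigma_subadditive.
pose nu : {outer_measure set T -> \bar R} := HB.pack outer_content oM.
have borel_cara : <<s (@open T) >> `<=` nu.-caratheodory.
  apply: smallest_sub.
    exact: (sigma_algebra_measurable (caratheodory_type nu)).
  move=> U oU; apply: le_caratheodory_measurable.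
  exact: outer_content_open_caratheodory.
pose B : measurableType _ := g_sigma_algebraType (@open T).
have sigma_add : semi_sigma_additive (outer_content : set B -> \bar R).
  move=> F mF tF mUF.
  apply: (caratheodory_measure_sigma_additive (mu := nu)) => //.
    by move=> i; exact: borel_cara (mF i).
  exact: borel_cara mUF.
pose mM := isMeasure.Build _ B R outer_content outer_content0 outer_content_ge0
  sigma_add.
pose mu : {measure set B -> \bar R} :=
  HB.pack (outer_content : set B -> \bar R) mM.
have muT : mu setT = 1.
  by rewrite /mu/= outer_content_open ?inner_content_setT//; exact: openT.
pose pM := Measure_isProbability.Build _ B R mu muT.
pose p : probability B R := HB.pack (outer_content : set B -> \bar R) mM pM.
exists p => U oU; exact: outer_content_open.
Qed.

(** Images of closed sets under [g] are closed because the space is compact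
Hausdorff; with preimages alone only one of the two inequalities would
follow. *)
Lemma inner_content_preimage (g : T -> T) U :
  continuous g -> (forall A, m (g @^-1` A) = m A) ->
  inner_content (g @^-1` U) = inner_content U.
Proof.
move=> cg mg; apply/eqP; rewrite eq_le; apply/andP; split.
  apply: inner_content_le => K cK KU.
  apply: (@le_trans _ _ (m (g @` K))%:E).
    by rewrite lee_fin -[leRHS]mg; apply: le_finadd; exact: preimage_image.
  apply: inner_content_ub; last by move=> _ [x /KU gx <-].
  apply: compact_closed => //; apply: continuous_compact.
    by apply: continuous_subspaceT => x; exact: cg.
  exact: subclosed_compact cK cT _.
apply: inner_content_le => K cK KU; rewrite -mg.
apply: inner_content_ub; last exact: preimage_subset.
by apply: preimage_closed => // x _; exact: cg.
Qed.

(** The regularization and its image under [g] agree on open sets, which form a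
generating family stable under intersection. The measure is the same for all
[g]: it depends on [m] only. *)
Lemma finadd_invariant_measure :
  exists mu : probability (g_sigma_algebraType (@open T)) R,
    forall g : T -> T, continuous g -> (forall A, m (g @^-1` A) = m A) ->
    forall A : set (g_sigma_algebraType (@open T)), measurable A ->
      mu (g @^-1` A) = mu A.
Proof.
have [mu muE] := regularization_borel_probability.
exists mu => g cg mg A mA.
pose B : measurableType _ := g_sigma_algebraType (@open T).
have mgB : measurable_fun setT (g : B -> B).
  apply: (@measurability _ _ B B setT g (@open T) erefl) => _ [V oV <-].
  rewrite setTI; apply: sub_sigma_algebra.
  by apply: open_comp => // x _; exact: cg.
pose h : {mfun B >-> B} :=
  HB.pack (g : B -> B) (isMeasurableFun.Build _ _ _ _ _ mgB).
have := @measure_unique _ R B (@open T) (fun=> setT) erefl (@openI T)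
  (fun=> openT).
move=> /(_ _ (pushforward mu h) mu); apply => //.
- by rewrite bigcup_const.
- move=> U oU; rewrite /= /pushforward !muE//; last first.
    by apply: open_comp => // x _; exact: cg.
  exact: inner_content_preimage.
- by move=> k; rewrite /= /pushforward preimage_setT probability_setT ltry.
Qed.

End Regularization.

(** * Topology of the complex plane and of the Riemann sphere *)

(** Local compactness is what separates a point of [X] from infinity: the
basic neighborhoods of infinity come from complements of closed compact
sets. *)
Lemma one_point_compactification_hausdorff (X : topologicalType) :
  hausdorff_space X -> (forall x : X, exists2 K, nbhs x K & compact K) ->
  hausdorff_space (one_point_compactification X).
Proof.
move=> hX lcX.
have separated (x : X) :
    ~ cluster (@nbhs _ (one_point_compactification X) None) (Some x).
  have [K nK cK] := lcX x.
  move=> /(_ (Some @` (~` K) `|` [set None]) (Some @` K))[||y].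
  - by exists K => //; split=> //; exact: compact_closed.
  - exact: one_point_compactification_some_nbhs.
  - move=> [+ [z Kz zy]]; rewrite -zy => -[[w nKw [wz]]|//].
    by apply: nKw; rewrite wz.
move=> [x|] [y|] //.
- move=> clxy; congr Some; apply: hX => A B nA nB.
  have [_ [[z Az <-] [w Bw [wz]]]] := clxy _ _
    (one_point_compactification_some_nbhs _ _ nA)
    (one_point_compactification_some_nbhs _ _ nB).
  by exists z; split=> //; rewrite -wz.
- move=> cl; exfalso; apply: (separated x) => A B nA nB.
  by rewrite setIC; exact: cl.
- by move=> /separated.
Qed.

Section ComplexPlane.
Variable R : realType.
Local Notation C := (R[i]^o).
Local Notation normc := (@Normc.normc R).

Lemma normc_continuous : continuous (normc : C -> R).
Proof.
move=> z; apply/(@cvgrPdist_lt R R^o C (nbhs z) _ normc) => e e0.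
have e0C : 0 < e%:C by rewrite ltcR.
near=> w; rewrite -ltcR.
apply: le_lt_trans (_ : `|z - w| < _).
  have := ler_dist_dist z w.
  rewrite -[`|z|]/((normc z)%:C) -[`|w|]/((normc w)%:C) -rmorphB/=.
  by rewrite normc_def/= expr0n/= addr0 sqrtr_sqr.
by near: w; apply: cvgr_dist_lt => //; exact: cvg_id.
Unshelve. all: by end_near. Qed.

Lemma normC_le_ReIm (a b : R) : `|a +i* b : C| <= (`|a| + `|b|)%:C.
Proof.
rewrite lecR -(@ler_pXn2r _ 2)// ?nnegrE ?sqrtr_ge0 ?addr_ge0//.
rewrite /normc sqr_sqrtr ?addr_ge0 ?sqr_ge0// sqrrD !real_normK ?num_real//.
by rewrite addrAC lerDl mulrn_wge0// mulr_ge0.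
Qed.

Lemma Complex_continuous : continuous (fun p : R * R => p.1 +i* p.2 : C).
Proof.
move=> [a b]; apply/cvgrPdist_lt => e e0.
have [r eE] : exists r, e = r%:C.
  by apply/complex_realP; exact: gtr0_real.
have r0 : 0 < r / 2 by rewrite divr_gt0// -ltcR -eE.
near=> p; apply: (@le_lt_trans _ _ (`|a - p.1| + `|b - p.2|)%:C).
  exact: normC_le_ReIm.
rewrite eE ltcR (splitr r) ltrD//.
  near: p; apply: (@cvgr_dist_lt _ _ _ (nbhs (a, b)) _ fst a) => //.
  exact: cvg_fst.
near: p; apply: (@cvgr_dist_lt _ _ _ (nbhs (a, b)) _ snd b) => //.
exact: cvg_snd.
Unshelve. all: by end_near. Qed.

(** A disc is closed in a square, the continuous image of a product of two
segments. *)
Lemma disc_compact (r : R) : compact [set z : C | normc z <= r].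
Proof.
pose square := `[- r, r]%classic `*` `[- r, r]%classic.
have sq_cpt : compact [set (p.1 +i* p.2 : C) | p in square].
  apply: continuous_compact;
    first exact/continuous_subspaceT/Complex_continuous.
  by apply: compact_setX; exact: segment_compact.
apply: subclosed_compact sq_cpt _.
  apply: (@preimage_closed C R normc [set x | x <= r]) => [x _|].
    exact: normc_continuous.
  exact: closed_le.
move=> [a b] /= abr.
exists (a, b) => //; split=> /=; rewrite in_itv/= -ler_norml.
  apply: le_trans abr; rewrite -(sqrtr_sqr a) ler_wsqrtr//.
  by rewrite lerDl sqr_ge0.
apply: le_trans abr; rewrite -(sqrtr_sqr b) ler_wsqrtr//.
by rewrite lerDr sqr_ge0.
Qed.

Lemma complex_compact_bounded (K : set C) : compact K ->
  exists r : R, forall z, K z -> normc z <= r.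
Proof.
move=> cK; have : compact (normc @` K).
  by apply: continuous_compact cK; exact/continuous_subspaceT/normc_continuous.
move=> /compact_bounded[r [_ rK]]; exists (r + 1) => z Kz.
apply: le_trans (ler_norm _) _; apply: rK; first by rewrite ltrDl.
by exists z.
Qed.

Lemma complex_horner_continuous (P : {poly R[i]}) :
  continuous (fun z : C => P.[z] : C).
Proof.
elim/poly_ind: P => [|P c IH] z.
  have -> : (fun w : C => (0 : {poly R[i]}).[w] : C) = cst 0.
    by apply/funext => w; rewrite horner0.
  exact: (@cst_continuous C C).
have -> : (fun w : C => (P * 'X + c%:P).[w] : C) = (fun w : C => P.[w] * w + c).
  by apply/funext => w; rewrite hornerMXaddC.
apply: (@continuousD R[i] C C (fun w => P.[w] * w) (cst c)).
  apply: (@continuousM R[i] C (fun w => P.[w]) id); first exact: IH.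
  exact: cvg_id.
exact: (@cst_continuous C C).
Qed.

End ComplexPlane.

Section Sphere.
Variable R : realType.
Local Notation C := (R[i]^o).
Local Notation normc := (@Normc.normc R).
Local Notation sphere := (riemann_sphere R).

Lemma sphere_compact : compact [set: sphere].
Proof. exact: one_point_compactification_compact. Qed.

Lemma sphere_hausdorff : hausdorff_space sphere.
Proof.
apply: one_point_compactification_hausdorff; first exact: norm_hausdorff.
move=> z; exists [set w : C | normc w <= normc z + 1]; last exact: disc_compact.
have : normc z < normc z + 1 by rewrite ltrDl ltr01.
by move=> /lt_le_nbhsl; exact: normc_continuous.
Qed.

Lemma nbhs_infinity_disc (r : R) :
  nbhs (None : sphere) [set p | forall z, p = Some z -> r < normc z].
Proof.
exists [set z : C | normc z <= r].
  split; first exact: disc_compact.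
  by apply: compact_closed; [exact: norm_hausdorff|exact: disc_compact].
by move=> _ [[w /negP + <-] z [<-]|->//]; rewrite -ltNge.
Qed.

Lemma cvg_infinity (T : Type) (F : set_system T) {FF : Filter F}
    (f : T -> sphere) :
  (forall r : R, \forall x \near F, forall z, f x = Some z -> r < normc z) ->
  f @ F --> (None : sphere).
Proof.
move=> hf A [K [cK _] KA]; have [r rK] := complex_compact_bounded cK.
apply: filterS (hf r) => x hx; apply: KA; case E : (f x) => [z|]; last by right.
left; exists z => // /rK; rewrite leNgt => /negP; apply; exact: hx.
Qed.

Lemma sphere_point_scale (c a b : R[i]) : c != 0 ->
  sphere_point (c * a) (c * b) = sphere_point a b.
Proof.
move=> c0; rewrite /sphere_point mulf_eq0 (negbTE c0)/=.
by case: ifPn => // b0; rewrite -mulf_div divff// mul1r.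
Qed.

(** Continuity of [(a, b) |-> [a : b]] at every [(a0, b0) != (0, 0)]. When
[b0 = 0], the quotient [a / b] eventually exceeds any bound wherever [b] does
not vanish, and the value is already infinity where it does. *)
Lemma cvg_sphere_point (T : Type) (F : set_system T) {FF : Filter F}
    (a b : T -> C) (a0 b0 : C) : a0 != 0 \/ b0 != 0 ->
  a @ F --> a0 -> b @ F --> b0 ->
  sphere_point (a x) (b x) @[x --> F] --> sphere_point a0 b0.
Proof.
move=> ab0 aF bF.
have [b00|b00] := eqVneq b0 0; last first.
  rewrite {2}/sphere_point (negbTE b00).
  apply: (@cvg_trans _ ((Some \o (fun x => a x / b x)) @ F)).
    apply: near_eq_cvg; near=> x; rewrite /= /sphere_point ifN//.
    by near: x; exact: cvgr_neq0 bF b00.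
  have abF : (fun x => a x * (b x)^-1 : C) @ F --> (a0 * b0^-1 : C).
    apply: (@cvgM R[i] T F _ a (fun x => (b x)^-1) a0 b0^-1 aF).
    exact: (@cvgV R[i] T F _ b b0 b00 bF).
  exact: cvg_comp abF (one_point_compactification_some_continuous (a0 / b0)).
have a00 : a0 != 0 by case: ab0 => //; rewrite b00 eqxx.
rewrite b00 {2}/sphere_point eqxx.
apply: cvg_infinity => r.
have na0 : 0 < normc a0 by rewrite -ltcR -[ltRHS]/(`|a0|) normr_gt0.
(* If |a| > |a0| / 2 and |b| < e then |a / b| > |r| + 1. *)
pose e := normc a0 / 2 / (`|r| + 1).
have r0 : 0 < `|r| + 1 by rewrite ltr_wpDl.
have e0 : 0 < e by rewrite !divr_gt0.
have bF0 : b @ F --> (0 : C) by rewrite -b00.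
near=> x => z; rewrite /sphere_point; case: ifPn => // bx0 [<-].
rewrite Normc.normcM Normc.normcV.
have nb0 : 0 < normc (b x) by rewrite -ltcR -[ltRHS]/(`|b x|) normr_gt0.
rewrite ltr_pdivlMr//.
apply: (@le_lt_trans _ _ ((`|r| + 1) * normc (b x))).
  by rewrite ler_wpM2r ?(ltW nb0)// (le_trans (ler_norm r))// lerDl.
apply: (@lt_trans _ _ (normc a0 / 2)).
  rewrite mulrC -ltr_pdivlMr// -ltcR; near: x.
  by apply: (cvgr0_norm_lt b bF0); rewrite ltcR.
rewrite -ltcR; near: x; apply: (cvgr_norm_gt _ aF).
by rewrite -[X in _ < X]/((normc a0)%:C) ltcR gtr_pMr// invf_lt1 ?ltr1n.
Unshelve. all: by end_near. Qed.

(** The local coordinate [1 / z] of the sphere near infinity. *)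
Definition sphere_inv (p : sphere) : C := if p is Some z then z^-1 else 0.

Lemma sphere_inv_cvg : sphere_inv @ (None : sphere) --> (0 : C).
Proof.
apply: (proj2 (@cvgr0Pnorm_lt R[i] C sphere (nbhs (None : sphere))
  (nbhs_filter (None : sphere)) sphere_inv)) => e e0.
have [r eE] : exists r, e = r%:C.
  by apply/complex_realP; exact: gtr0_real.
have r0 : 0 < r by rewrite -ltcR -eE.
apply: filterS (nbhs_infinity_disc r^-1) => -[z|] /= hz; last by rewrite normr0.
have := hz z erefl => rz; rewrite eE -[X in X < _]/((normc z^-1)%:C) ltcR.
rewrite Normc.normcV invf_plt// posrE//.
by rewrite (lt_trans _ rz)// invr_gt0.
Qed.

(** The polynomial ['X^n P(1 / 'X)]. *)
Definition rev_poly (n : nat) (P : {poly R[i]}) : {poly R[i]} :=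
  \poly_(i < n.+1) P`_(n - i).

Lemma rev_poly0 n (P : {poly R[i]}) : (rev_poly n P).[0] = P`_n.
Proof. by rewrite horner_coef0 coef_poly subn0. Qed.

Lemma horner_rev_poly n (P : {poly R[i]}) (w : R[i]) :
  (size P <= n.+1)%N -> w != 0 ->
  P.[w] = w ^+ n * (rev_poly n P).[w^-1].
Proof.
move=> sP w0; rewrite (horner_coef_wide _ sP) horner_poly.
rewrite (reindex_inj rev_ord_inj)/= mulr_sumr; apply: eq_bigr => i _.
rewrite subSS mulrCA; congr (_ * _).
by rewrite exprVn -expfB_cond // (negbTE w0) leq_ord.
Qed.

(** Near infinity, dividing numerator and denominator by [w ^+ n] turns
[[P(w) : Q(w)]] into the same expression for the reversed polynomials at
[1 / w], which are evaluated at [0] at infinity itself. Coprimality excludes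
the value [[0 : 0]] at finite points; it also prevents both polynomials from
vanishing, so that at infinity [[0 : 0]] is excluded by the leading coefficient
of the one of larger degree. *)
Lemma rational_map_continuous (f : sphere -> sphere) :
  rational_map f -> continuous f.
Proof.
move=> [P [Q [PQ ->]]] [z|].
  apply: (@cvg_sphere_point _ (nbhs z) _ (fun w => P.[w]) (fun w => Q.[w]));
    try exact: complex_horner_continuous.
  have [Pz|Pz] := eqVneq P.[z] 0; [right|by left].
  by apply: coprimep_root PQ _; apply/eqP.
set n := (maxn (size P) (size Q)).-1.
have sP : (size P <= n.+1)%N by apply: leq_trans (leqSpred _); exact: leq_maxl.
have sQ : (size Q <= n.+1)%N by apply: leq_trans (leqSpred _); exact: leq_maxr.
have near0 : \forall p \near (None : sphere),
    sphere_point (rev_poly n P).[sphere_inv p] (rev_poly n Q).[sphere_inv p] =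
    rational_eval P Q p.
  apply: filterS (nbhs_infinity_disc 0) => -[w|] /= hw; last first.
    by rewrite !rev_poly0.
  have w0 : w != 0.
    by apply/eqP => w0; have := hw w erefl; rewrite w0 Normc.normc0 ltxx.
  rewrite (horner_rev_poly sP w0) (horner_rev_poly sQ w0).
  by rewrite sphere_point_scale ?expf_neq0.
apply: cvg_trans (near_eq_cvg near0) _.
rewrite [rational_eval P Q None]/= -/n -(rev_poly0 n P) -(rev_poly0 n Q).
apply: cvg_sphere_point; last 2 first.
- apply: (cvg_comp _ _ sphere_inv_cvg); exact: complex_horner_continuous.
- apply: (cvg_comp _ _ sphere_inv_cvg); exact: complex_horner_continuous.
rewrite !rev_poly0.
have [sPQ|sQP] := leqP (size P) (size Q).
  right; have -> : n = (size Q).-1 by rewrite /n (maxn_idPr sPQ).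
  rewrite -lead_coefE lead_coef_eq0; apply/eqP => Q0.
  move: sPQ PQ; rewrite Q0 size_poly0 leqn0 size_poly_eq0 => /eqP ->.
  by rewrite coprimep0 -size_poly_eq1 size_poly0.
left; have -> : n = (size P).-1 by rewrite /n (maxn_idPl (ltnW sQP)).
rewrite -lead_coefE lead_coef_eq0; apply/eqP => P0.
by move: sQP; rewrite P0 size_poly0.
Qed.

End Sphere.

(** * From an invariant mean to an invariant measure *)

Section MeanDistribution.
Variables (R : realType) (S : semigroupType) (M : {linear Linf R S -> R[i]^o}).
Hypothesis mean_M : is_mean M.
Variables (X : Type) (f : S -> X).
Implicit Types A B : set X.

Lemma visit_bounded A : bounded_fun (\1_(f @^-1` A) : S -> R[i]^o).
Proof.
apply/Defs.bounded_funP; exists 1 => s.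
by rewrite indicE; case: (_ \in _); rewrite ?normr1 ?normr0 ?ler01.
Qed.

Definition visit A : Linf R S := Linf_of (visit_bounded A).

Lemma mean_visit_ge0 A : 0 <= M (visit A).
Proof. by case: mean_M => M0 _ _; apply: M0 => s; rewrite /= indicE ler0n. Qed.

Lemma mean_visit_setT : complex.Re (M (visit setT)) = 1.
Proof.
case: mean_M => _ _ M1; have -> : visit setT = Linf_one R S.
  by apply/LinfP => s; rewrite /= preimage_setT indicT.
by rewrite M1.
Qed.

Lemma mean_visitU A B : A `&` B = set0 ->
  complex.Re (M (visit (A `|` B))) =
  complex.Re (M (visit A)) + complex.Re (M (visit B)).
Proof.
move=> AB0; have -> : visit (A `|` B) = visit A + visit B.
  apply/LinfP => s; rewrite /= preimage_setU !indicE.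
  rewrite -[RHS]/(\1_(f @^-1` A) s + \1_(f @^-1` B) s) !indicE in_setU.
  have [As|_] := boolP (s \in f @^-1` A); last by rewrite add0r.
  have [Bs|_] := boolP (s \in f @^-1` B); last by rewrite addr0.
  have : (A `&` B) (f s) by split; exact/set_mem.
  by rewrite AB0.
have ReD (z w : R[i]) : complex.Re (z + w) = complex.Re z + complex.Re w.
  by case: z; case: w.
by rewrite raddfD; exact: ReD.
Qed.

Lemma Re_mean_visit_ge0 A : 0 <= complex.Re (M (visit A)).
Proof. by have := mean_visit_ge0 A; rewrite lecE => /andP[]. Qed.

(** The means of indicator functions are nonnegative complex numbers, hence
real, so taking the real part loses nothing. *)
Definition mean_distribution : finadd_probability X R :=
  FinaddProbability Re_mean_visit_ge0 mean_visit_setT mean_visitU.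

End MeanDistribution.

Theorem corollary14 (R : realType) (S : rational_semigroup R) :
  left_amenable R (ratsg_elt S) ->
  exists mu : probability (borel_sphere R) R,
    forall g : riemann_sphere R -> riemann_sphere R, ratsg_set S g ->
      forall A : set (borel_sphere R), measurable A ->
        pushforward mu (g : borel_sphere R -> borel_sphere R) A = mu A.
Proof.
move=> [M [mean_M invM]].
pose orbit (s : ratsg_elt S) : riemann_sphere R := val s None.
pose m := mean_distribution mean_M orbit.
have [mu mu_inv] := finadd_invariant_measure m (@sphere_hausdorff R)
  (@sphere_compact R).
exists mu => g Sg A mA; apply: mu_inv => //.
  exact: rational_map_continuous (ratsg_rational Sg).
move=> B; rewrite /m/=; congr (complex.Re _).
pose s : ratsg_elt S := exist _ g (mem_set Sg).
rewrite -[RHS](invM s); congr (M _).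
by apply/LinfP.
Qed.
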